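(* Let $\sigma$ be a measurable function on $\mathfrak X\times\Omega\times[0,\tau]$ and let $1\le p_1,p_2<\infty$. Then the pseudo-differential operator $T_\sigma:L^{p_1}(\mathfrak X)\to L^{p_2}(\mathfrak X)$ is nuclear if and only if there exist sequences $\{g_k\}_{k=1}^\infty$ in $L^{p_1'}(\mathfrak X)$ and $\{f_k\}_{k=1}^\infty$ in $L^{p_2}(\mathfrak X)$ such that $$\sum_{k=1}^\infty\|g_k\|_{L^{p_1'}(\mathfrak X)}\|f_k\|_{L^{p_2}(\mathfrak X)}<\infty$$ and for all $x,y\in\mathfrak X$, $$\int_\Omega\int_0^\tau q^{(\frac12-is)h_\omega(x)}\,q^{(\frac12+is)h_\omega(y)}\,\sigma(x,\omega,s)\,d\nu(\omega)\,d\mu(s)=\sum_{k=1}^\infty f_k(x)g_k(y).$$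
   Context: Let $q\ge 2$ be an integer and let $\mathfrak X$ be (the vertex set of) the homogeneous tree of degree $q+1$: the connected graph without loops (cycles) in which every vertex has exactly $q+1$ neighbours. $d(x,y)$ is the number of edges of the geodesic from $x$ to $y$; a reference vertex $o$ is fixed and $|x|=d(o,x)$. $\mathfrak X$ carries the counting measure and $L^p(\mathfrak X)$ is taken with respect to it; $p'$ denotes the conjugate exponent of $p$. $\Omega$ is the set of infinite geodesic rays $\omega=(\omega_0,\omega_1,\dots)$ with $\omega_0=o$. The height function is $h_\omega(x)=\lim_{m\to\infty}(m-d(x,\omega_m))=2|c(x,\omega)|-|x|$, where $c(x,\omega)$ is the last vertex on the geodesic path $[o,x]$ that lies on $\omega$. $\nu$ is the probability measure on $\Omega$ (with the $\sigma$-algebra generated by the sets $E(x)=\{\omega:\omega\text{ passes through }x\}$) with $\nu(E(x))=\frac{q}{(q+1)q^{|x|}}$ for $x\neq o$. Put $\tau=\pi/\log q$ and $d\mu(s)=c_P|c(s)|^{-2}ds$ on $[0,\tau]$, with $c_P=\frac{q\log q}{2\pi(q+1)}$ and $c(z)=\frac{q^{1/2}}{q+1}\,\frac{q^{1/2+iz}-q^{-1/2-iz}}{q^{iz}-q^{-iz}}$. For finitely supported $f:\mathfrak X\to\mathbb C$ the Fourier-Helgason transform is $\mathcal Hf(\omega,s)=\sum_{y\in\mathfrak X}f(y)q^{(\frac12+is)h_\omega(y)}$. For measurable $\sigma$ and finitely supported $f$, the pseudo-differential operator with symbol $\sigma$ is $T_\sigma f(x)=\int_\Omega\int_0^\tau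 q^{(\frac12-is)h_\omega(x)}\sigma(x,\omega,s)\mathcal Hf(\omega,s)\,d\nu(\omega)d\mu(s)$. Saying that $T_\sigma$ is an operator of a given class between $L^p$ spaces means that this integral converges absolutely for all finitely supported $f$ and all $x$, and that $T_\sigma$ extends from finitely supported functions to an operator of that class; integrals in the claim are understood as absolutely convergent. A bounded linear operator $T:X\to Y$ of complex Banach spaces is nuclear if there are sequences $\{x_n'\}$ in the dual $X'$ and $\{y_n\}$ in $Y$ with $\sum_n\|x_n'\|_{X'}\|y_n\|_Y<\infty$ and $Tx=\sum_n x_n'(x)y_n$ for all $x\in X$. *)

(* Defs.v *)
From HB Require Import structures.
From mathcomp Require Import all_boot all_order all_algebra complex.
From mathcomp Require Import all_classical all_reals all_analysis.
From mathcomp Require Import measurable_realfun.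

Set Implicit Arguments.
Unset Strict Implicit.
Unset Printing Implicit Defensive.

Import Order.TTheory GRing.Theory Num.Theory.
Import numFieldNormedType.Exports.

Local Open Scope classical_set_scope.
Local Open Scope card_scope.
Local Open Scope ring_scope.
Local Open Scope complex_scope.

(* The hypothesis [2 <= q] is part of the structure: it is what makes the space
   of rays below nonempty, as the library requires of a measurable type. *)
Record htree (q : nat) := HTree {
  htree_sort : choiceType;
  adj : rel htree_sort;
  root : htree_sort;
  htree_q_ge2 : (2 <= q)%N;
  adj_sym : symmetric adj;
  adj_irr : irreflexive adj;
  adj_connected : forall x y, exists2 p, path adj x p & last x p = y;
  (* an edge traversed back and forth is a [ucycle] of size 2 *)
  adj_acyclic : forall p, ucycle adj p -> (size p <= 2)%N;
  adj_regular : forall x, [set y | adj x y] #= `I_q.+1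
}.

Definition vertex (q : nat) (X : htree q) : Type := htree_sort X.
Coercion vertex : htree >-> Sortclass.

HB.instance Definition _ (q : nat) (X : htree q) :=
  Choice.copy (vertex X) (htree_sort X).
HB.instance Definition _ (q : nat) (X : htree q) :=
  isPointed.Build (vertex X) (root X).
HB.instance Definition _ (q : nat) (X : htree q) :=
  @isMeasurable.Build default_measure_display (vertex X)
    discrete_measurable discrete_measurable0
    discrete_measurableC discrete_measurableU.

Section distance.
Context (q : nat) (X : htree q).
Implicit Types x y z : X.

Definition walk x y n :=
  `[< exists p, [/\ path (@adj q X) x p, last x p = y & size p = n] >].

Lemma walk_exists x y : exists n, walk x y n.
Proof.
have [p xp py] := @adj_connected q X x y.
by exists (size p); apply/asboolP; exists p.
Qed.

(* A shortest walk from [x] to [y] is the geodesic. *)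
Definition dist x y : nat := ex_minn (walk_exists x y).

Definition vnorm x : nat := dist (root X) x.

Lemma dist_walk x y :
  exists p, [/\ path (@adj q X) x p, last x p = y & size p = dist x y].
Proof. by rewrite /dist; case: ex_minnP => n /asboolP. Qed.

Lemma dist_le x p : path (@adj q X) x p -> (dist x (last x p) <= size p)%N.
Proof.
move=> xp; rewrite /dist; case: ex_minnP => n _; apply.
by apply/asboolP; exists p.
Qed.

Lemma distxx x : dist x x = 0%N.
Proof. by apply/eqP; rewrite -leqn0 (@dist_le x [::]). Qed.

Lemma dist0 x y : dist x y = 0%N -> x = y.
Proof.
by move=> xy0; have [[|z p] []] := dist_walk x y; rewrite xy0.
Qed.

Lemma dist_triangle x y z : (dist x z <= dist x y + dist y z)%N.
Proof.
have [p [xp py <-]] := dist_walk x y; have [r [yr rz <-]] := dist_walk y z.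
rewrite -size_cat -rz -py -last_cat; apply: dist_le.
by rewrite cat_path xp py.
Qed.

Lemma adjC x y : adj x y = adj y x. Proof. exact: adj_sym. Qed.

Lemma last_rev_belast x p : last (last x p) (rev (belast x p)) = x.
Proof. by case: p => [|a p] //=; rewrite rev_cons last_rcons. Qed.

Lemma path_rev x p : path (@adj q X) x p ->
  path (@adj q X) (last x p) (rev (belast x p)).
Proof. by rewrite rev_path; apply: sub_path => a b; rewrite adjC. Qed.

Lemma dist_sym x y : dist x y = dist y x.
Proof.
wlog suff H : x y / (dist x y <= dist y x)%N.
  by apply/eqP; rewrite eqn_leq !H.
have [p [yp px <-]] := dist_walk y x.
have := dist_le (path_rev yp).
by rewrite size_rev size_belast last_rev_belast px.
Qed.

Lemma dist_adj x y : adj x y -> (dist x y <= 1)%N.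
Proof. by move=> xy; apply: (@dist_le x [:: y]); rewrite /= xy. Qed.

Definition joined_off x y z :=
  exists p, [/\ path (@adj q X) y p, last y p = z & x \notin y :: p].

Lemma joined_off_root x y : y != x -> (vnorm y <= vnorm x)%N ->
  joined_off x y (root X).
Proof.
move=> yx; rewrite /vnorm !(dist_sym (root X)) => yle.
have [p [yp pr sp]] := dist_walk y (root X).
exists p; split => //; rewrite inE eq_sym (negPf yx) /=.
apply/negP => /splitPr xp; case: xp yp pr sp => p1 p2.
rewrite cat_path /= => /and3P[_ _ xp2].
rewrite last_cat /= => pr; rewrite size_cat /= => sp.
have := dist_le xp2; rewrite pr => xle.
have := leq_trans yle xle.
by rewrite -sp addnS ltnNge leq_addl.
Qed.

Lemma joined_off_sym x y z : joined_off x y z -> joined_off x z y.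
Proof.
move=> [p [yp pz xp]]; exists (rev (belast y p)); split.
- by rewrite -pz; exact: path_rev.
- by rewrite -pz last_rev_belast.
- by rewrite -pz -rev_rcons -lastI mem_rev.
Qed.

Lemma joined_off_trans x y z t :
  joined_off x y z -> joined_off x z t -> joined_off x y t.
Proof.
move=> [p [yp pz xp]] [r [zr rt xr]]; exists (p ++ r); split.
- by rewrite cat_path yp pz.
- by rewrite last_cat pz.
- by move: xp xr; rewrite !inE mem_cat !negb_or => /andP[-> ->] /andP[_ ->].
Qed.

Lemma adj_joined_off x y z :
  adj x y -> adj x z -> joined_off x y z -> y = z.
Proof.
move=> xy xz [p [yp]]; case/shortenP: yp => p' yp' up' sp' pz xp.
have := @adj_acyclic q X (x :: y :: p').
rewrite /ucycle /= rcons_path xy yp' pz (adjC z) xz -/(uniq (y :: p')).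
rewrite up' andbT.
have -> : x \notin y :: p'.
  apply: contra xp; rewrite !inE => /orP[->//|/sp' ->]; exact: orbT.
by move=> /(_ isT); case: p' pz {yp' up' sp'}.
Qed.

Lemma exists_farther x : exists y, adj x y && (vnorm y == (vnorm x).+1).
Proof.
apply: contrapT => /forallNP noy.
have le y : adj x y -> joined_off x y (root X).
  move=> xy; apply: joined_off_root.
    by apply/eqP => yx; move: xy; rewrite yx adj_irr.
  have := dist_triangle (root X) x y; rewrite -/(vnorm _) -/(vnorm _) => yle.
  have {}yle : (vnorm y <= (vnorm x).+1)%N.
    by rewrite (leq_trans yle)// -addn1 leq_add2l dist_adj.
  move: yle; rewrite leq_eqVlt ltnS.
  by move/negP: (noy y); rewrite xy /= => /negPf ->.
have := @adj_regular q X x; set N := [set y | _] => Nq.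
suff N1 : N #<= `I_1.
  have := card_le_II q.+1 1; rewrite -(card_le_eql Nq) N1 => /esym.
  by rewrite ltnNge (ltnW (htree_q_ge2 X)).
have [->|/set0P[y xy]] := eqVneq N set0; first by rewrite card_ge0.
rewrite -(card_le_eqr (@card_set1 _ y)); apply: subset_card_le => z xz /=.
apply: (@adj_joined_off x) => //.
by apply: joined_off_trans (le _ xz) _; exact/joined_off_sym/le.
Qed.

End distance.

Section boundary.
Context (q : nat) (X : htree q).

Record ray := Ray {
  ray_fun :> nat -> X;
  ray_root : ray_fun 0%N = root X;
  ray_geodesic : forall m n, (m <= n)%N ->
    dist (ray_fun m) (ray_fun n) = (n - m)%N
}.

HB.instance Definition _ := gen_eqMixin ray.
HB.instance Definition _ := gen_choiceMixin ray.

Lemma ray_exists : $| ray |.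
Proof.
pose next (x : X) := xchoose (exists_farther x).
have nextP x : adj x (next x) /\ vnorm (next x) = (vnorm x).+1.
  by have /andP[? /eqP] := xchooseP (exists_farther x).
pose w n := iter n next (root X).
have w_norm n : vnorm (w n) = n.
  elim: n => [|n IHn]; first exact: distxx.
  by rewrite [LHS](nextP (w n)).2 IHn.
have w_le m k : (dist (w m) (w (m + k)%N) <= k)%N.
  elim: k => [|k IHk]; first by rewrite addn0 distxx.
  rewrite addnS (leq_trans (dist_triangle _ (w (m + k)%N) _))//.
  by rewrite -[leqRHS]addn1 leq_add// dist_adj//; exact: (nextP _).1.
apply: squash; apply: (@Ray w erefl) => m n mn.
apply/eqP; rewrite eqn_leq -{1}(subnKC mn) w_le /= leq_subLR.
rewrite -{1}(w_norm n) -{1}(w_norm m).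
exact: dist_triangle.
Qed.

HB.instance Definition _ := isPointed.Build ray (unsquash ray_exists).

Definition sector (x : X) : set ray := [set w | exists n, w n = x].

Definition boundary := g_sigma_algebraType (range sector).

End boundary.

Section height.
Context (R : realType) (q : nat) (X : htree q).

(* The sequence is eventually constant. *)
Definition height (w : boundary X) (x : X) : R :=
  limn (fun m : nat => m%:R - (dist x ((w : ray X) m))%:R : R).

Definition is_boundary_measure (nu : probability (boundary X) R) : Prop :=
  forall x : X, x != root X ->
    nu (sector x) = (q%:R / (q.+1%:R * q%:R ^+ vnorm x))%:E.

End height.

Section complex_functions.
Context (R : realType).
Implicit Types z : R[i].

Definition cmod z : R := ComplexField.Normc.normc z.

Definition cexp z : R[i] :=
  (expR (complex.Re z))%:C * (cos (complex.Im z) +i* sin (complex.Im z)).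

Definition cpow (a : R) z : R[i] := cexp (z * (ln a)%:C).

Lemma cpowE (a x y : R) : cpow a (x +i* y) =
  (expR (x * ln a) * cos (y * ln a)) +i* (expR (x * ln a) * sin (y * ln a)).
Proof.
rewrite /cpow /cexp; apply/eqP.
by rewrite eq_complex /= !mulr0 !mul0r !subr0 !add0r !addr0 !eqxx.
Qed.

Context d (T : measurableType d) (mu : {measure set T -> \bar R}).

Definition cmeasurable (D : set T) (f : T -> R[i]) : Prop :=
  measurable_fun D (fun t => complex.Re (f t)) /\
  measurable_fun D (fun t => complex.Im (f t)).

Definition cintegrable (D : set T) (f : T -> R[i]) : Prop :=
  cmeasurable D f /\ (\int[mu]_(t in D) (cmod (f t))%:E < +oo)%E.

Definition cintegral (D : set T) (f : T -> R[i]) : R[i] :=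
  (\int[mu]_(t in D) complex.Re (f t))%R +i*
  (\int[mu]_(t in D) complex.Im (f t))%R.

End complex_functions.

Section plancherel_density.
Context (R : realType) (q : nat).

Definition tau : R := pi / ln q%:R.

Definition c_fun (z : R[i]) : R[i] :=
  ((q%:R `^ 2^-1) / q.+1%:R)%:C *
  ((cpow q%:R (2^-1 + 'i%C * z) - cpow q%:R (- 2^-1 - 'i%C * z)) /
   (cpow q%:R ('i%C * z) - cpow q%:R (- ('i%C * z)))).

Definition c_P : R := q%:R * ln q%:R / (2 * pi * q.+1%:R).

(* At the endpoints [0] and [tau] the denominator of [c_fun] vanishes; the
   convention [0^-1 = 0] then gives the density its limit value [0]. *)
Definition plancherel_density (s : R) : R := c_P * cmod (c_fun s%:C) ^- 2.

End plancherel_density.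

(* The tree is an argument because [plancherel] is a measure, and a finite one,
   by [2 <= q]. *)
Definition plancherel (R : realType) (q : nat) (X : htree q) (A : set R)
    : \bar R :=
  (\int[lebesgue_measure]_(s in A `&` `[0%R, tau R q])
    (plancherel_density q s)%:E)%E.

Section plancherel_measure.
Context (R : realType) (q : nat) (X : htree q).

Local Notation tau := (tau R q).
Local Notation c_P := (c_P R q).
Local Notation plancherel_density := (@plancherel_density R q).
Local Notation plancherel := (@plancherel R q X).

Let L : R := ln q%:R.
Let L_gt0 : 0 < L.
Proof. by rewrite ln_gt0// ltr1n; exact: htree_q_ge2 X. Qed.

Lemma c_P_ge0 : 0 <= c_P.
Proof.
by rewrite divr_ge0// ?mulr_ge0// ?ler0n ?pi_ge0// (ltW L_gt0).
Qed.

Lemma plancherel_density_ge0 s : 0 <= plancherel_density s.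
Proof. by rewrite mulr_ge0 ?c_P_ge0// invr_ge0 exprn_ge0// sqrtr_ge0. Qed.

Let a : R := expR (2^-1 * L).
Let b : R := expR (- (2^-1 * L)).

Let num2 (t : R) : R := ((a - b) * cos t) ^+ 2 + ((a + b) * sin t) ^+ 2.

Let ab_gt0 : 0 < a - b.
Proof.
have hL : 0 < 2^-1 * L by rewrite mulr_gt0.
by rewrite subr_gt0 ltr_expR (lt_trans _ hL)// oppr_lt0.
Qed.

Let num2_ge t : (a - b) ^+ 2 <= num2 t.
Proof.
have -> : (a - b) ^+ 2 = ((a - b) * cos t) ^+ 2 + ((a - b) * sin t) ^+ 2.
  by rewrite !exprMn -mulrDr cos2Dsin2 mulr1.
rewrite lerD2l !exprMn ler_wpM2r ?sqr_ge0// ler_sqr ?nnegrE.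
- by rewrite lerD2l (@le_trans _ _ 0)// ?oppr_le0 expR_ge0.
- exact: ltW.
- by rewrite addr_ge0// ltW// expR_gt0.
Qed.

Let num2_gt0 t : 0 < num2 t.
Proof. by rewrite (lt_le_trans _ (num2_ge t))// exprn_gt0. Qed.

Lemma plancherel_densityE : exists2 c, 0 <= c & forall s,
  plancherel_density s = c * (sin (s * L) ^+ 2 / num2 (s * L)).
Proof.
exists (c_P * (cmod ((q%:R `^ 2^-1 / q.+1%:R)%:C)) ^- 2 * 4).
  by rewrite 2?mulr_ge0 ?c_P_ge0 ?invr_ge0 ?exprn_ge0 ?sqrtr_ge0.
move=> s; rewrite /Defs.plancherel_density /c_fun /cmod.
rewrite !ComplexField.Normc.normcM ComplexField.Normc.normcV.
set k := ComplexField.Normc.normc _.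
have hE : (2^-1 : R[i]) = (2^-1 : R)%:C by rewrite fmorphV rmorph_nat.
have iE x : 'i%C * x%:C = 0 +i* x.
  apply/eqP; rewrite eq_complex /= !mul0r !mul1r sub0r ?oppr0 ?addr0.
  by rewrite ?add0r !eqxx.
rewrite iE hE -!rmorphN; set N := cpow _ _ - cpow _ _.
set D := cpow _ _ - cpow _ _.
have -> : ComplexField.Normc.normc N = Num.sqrt (num2 (s * L)).
  rewrite /N (_ : (2^-1)%:C + _ = 2^-1 +i* s); last first.
    apply/eqP.
    by rewrite eq_complex /= ?sub0r ?oppr0 ?addr0 ?add0r ?subr0 !eqxx.
  rewrite (_ : (- 2^-1)%:C - _ = (- 2^-1) +i* (- s)); last first.
    apply/eqP.
    by rewrite eq_complex /= ?sub0r ?oppr0 ?addr0 ?add0r ?subr0 !eqxx.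
  rewrite !cpowE /= -/L !mulNr cosN sinN -/a -/b mulrN opprK.
  by rewrite -mulrBl -mulrDl.
have -> : ComplexField.Normc.normc D = Num.sqrt (4 * sin (s * L) ^+ 2).
  rewrite /D (_ : - (0 +i* s) = 0 +i* (- s)); last first.
    apply/eqP.
    by rewrite eq_complex /= ?sub0r ?oppr0 ?addr0 ?add0r ?subr0 !eqxx.
  rewrite !cpowE /= -/L !mulNr cosN sinN mul0r expR0 !mul1r subrr.
  rewrite expr0n/= add0r.
  by rewrite opprK -mulr2n exprMn_n -mulr_natl.
have expVE (k1 n1 d1 : R) :
    (k1 * (n1 / d1)) ^- 2 = k1 ^- 2 * (d1 ^+ 2 / n1 ^+ 2).
  rewrite exprMn invfM; congr (_ * _).
  by rewrite exprMn exprVn invfM invrK mulrC.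
rewrite expVE !sqr_sqrtr ?(mulr_ge0 _ (sqr_ge0 _)) ?(ltW (num2_gt0 _))//.
by rewrite -(mulrA 4) !(mulrA c_P) (mulrA _ 4).
Qed.

Lemma continuous_plancherel_density : continuous plancherel_density.
Proof.
have [c _ cE] := plancherel_densityE.
rewrite (_ : plancherel_density =
    fun s => c * (sin (s * L) ^+ 2 / num2 (s * L))).
  move=> s; apply: cvgM; first exact: cvg_cst.
  have sL : s' * L @[s' --> s] --> s * L.
    by apply: cvgM; [exact: cvg_id|exact: cvg_cst].
  have csin : sin (s' * L) @[s' --> s] --> sin (s * L).
    exact: (cvg_comp _ _ sL (@continuous_sin R _)).
  have ccos : cos (s' * L) @[s' --> s] --> cos (s * L).
    exact: (cvg_comp _ _ sL (@continuous_cos R _)).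
  apply: cvgM; first by rewrite !expr2; exact: cvgM.
  apply: cvgV; first by rewrite gt_eqF.
  rewrite /num2; apply: cvgD; apply: cvgM; apply: cvgM => //; exact: cvg_cst.
by apply/funext => s.
Qed.

Lemma measurable_plancherel_density : measurable_fun setT plancherel_density.
Proof.
apply: continuous_measurable_fun.
exact: continuous_plancherel_density.
Qed.

Let measurable_density (D : set R) :
  measurable_fun D (fun s => (plancherel_density s)%:E).
Proof.
apply/measurable_EFinP; exact: measurable_funTS measurable_plancherel_density.
Qed.

Lemma plancherel_density_bounded :
  exists M, forall s, plancherel_density s <= M.
Proof.
have [c c0 cE] := plancherel_densityE.
exists (c * ((a - b) ^+ 2)^-1) => s; rewrite cE ler_wpM2l//.
rewrite -[leRHS]mul1r; apply: ler_pM.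
- exact: sqr_ge0.
- by rewrite invr_ge0 (ltW (num2_gt0 _)).
- by rewrite -(cos2Dsin2 (s * L)) lerDr sqr_ge0.
- by rewrite lef_pV2 ?num2_ge// posrE ?exprn_gt0.
Qed.

Let plancherel0 : plancherel set0 = 0%E.
Proof. by rewrite /Defs.plancherel set0I integral_set0. Qed.

Let plancherel_ge0 A : (0 <= plancherel A)%E.
Proof.
by apply: integral_ge0 => s _; rewrite lee_fin plancherel_density_ge0.
Qed.

Let plancherel_sigma_additive : semi_sigma_additive plancherel.
Proof.
move=> F mF tF mUF; rewrite /Defs.plancherel setI_bigcupl.
apply: cvg_toP.
  apply: ereal_nondecreasing_is_cvgn => m n mn.
  by apply: lee_sum_nneg_natr => // k _ _; exact: plancherel_ge0.
rewrite ge0_integral_bigcup//=.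
- by move=> k; apply: measurableI; [exact: mF|exact: measurable_itv].
- exact: measurable_density.
- by move=> x _; rewrite lee_fin plancherel_density_ge0.
- by apply: (@trivIset_setIr _ _ setT F (fun=> `[0, tau]%classic)).
Qed.

HB.instance Definition _ := isMeasure.Build _ _ _ plancherel
  plancherel0 plancherel_ge0 plancherel_sigma_additive.

Let plancherel_fin : fin_num_fun plancherel.
Proof.
move=> A mA; rewrite ge0_fin_numE//.
have [M dM] := plancherel_density_bounded.
apply: (@le_lt_trans _ _ (\int[lebesgue_measure]_(s in `[0%R, tau]) M%:E)%E).
  apply: (@le_trans _ _
      (\int[lebesgue_measure]_(s in A `&` `[0%R, tau]) M%:E)%E).
    apply: ge0_le_integral => //=.
    - exact: measurableI.
    - by move=> s _; rewrite lee_fin plancherel_density_ge0.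
    - exact: measurable_density.
    - by move=> s _; rewrite lee_fin.
  apply: ge0_subset_integral => //=.
  - exact: measurableI.
  - by move=> s _; rewrite lee_fin (le_trans (plancherel_density_ge0 s)).
rewrite integral_cst//= lebesgue_measure_itv /=.
by case: ifP => _; rewrite ?mule0 ?ltry// -EFinD -EFinM ltry.
Qed.

HB.instance Definition _ :=
  @Measure_isFinite.Build _ _ _ plancherel plancherel_fin.

End plancherel_measure.

(* A normed space is given by a complex vector space [E] and an extended norm
   [N] on it, as the subspace of the vectors of finite norm.  Operators are
   total functions on [E]; only their values on that subspace matter. *)
Section nuclear.
Context (R : realType).
Implicit Types E F : lmodType R[i].

Definition fin_norm E (N : E -> \bar R) : set E := [set x | (N x < +oo)%E].

Definition bounded_linear E F (NE : E -> \bar R) (NF : F -> \bar R)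
    (T : E -> F) : Prop :=
  (forall (a : R[i]) x y, fin_norm NE x -> fin_norm NE y ->
    T (a *: x + y) = a *: T x + T y) /\
  (exists M : R, forall x, fin_norm NE x -> (NF (T x) <= M%:E * NE x)%E).

Definition op_norm E F (NE : E -> \bar R) (NF : F -> \bar R)
    (T : E -> F) : \bar R :=
  ereal_sup [set NF (T x) | x in [set x | (NE x <= 1)%E]].

Definition cabs (z : R[i]^o) : \bar R := (cmod z)%:E.

Definition nuclear E F (NE : E -> \bar R) (NF : F -> \bar R)
    (T : E -> F) : Prop :=
  bounded_linear NE NF T /\
  exists (x' : nat -> E -> R[i]^o) (y : nat -> F),
    [/\ forall n, bounded_linear NE cabs (x' n),
        forall n, fin_norm NF (y n),
        (\sum_(n <oo) op_norm NE cabs (x' n) * NF (y n) < +oo)%E &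
        forall x, fin_norm NE x ->
          NF (T x - \sum_(n < m) x' n x *: y n) @[m --> \oo] --> 0%E].

End nuclear.

Section pseudo_differential.
Context (R : realType) (q : nat) (X : htree q).
Implicit Types (f g : X -> R[i]^o) (x y : X) (w : boundary X) (s : R).

Definition lp_norm (p : \bar R) f : \bar R :=
  Lnorm (@counting X R) p (fun x => (cmod (f x))%:E).

Definition finitely_supported f : Prop := finite_set [set x | f x != 0].

(* [q ^ ((1/2 + i s) h_w(x))]; the conjugate exponent is obtained at [- s]. *)
Definition plane_wave s w x : R[i] :=
  cpow q%:R ((2^-1 +i* s) * (height R w x)%:C).

Definition fourier_helgason f w s : R[i] :=
  \sum_(y \in [set: X]) f y * plane_wave s w y.

Context (nu : probability (boundary X) R).
Context (sigma : X -> boundary X -> R -> R[i]).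

Definition symbol_measurable : Prop :=
  cmeasurable ([set: X * boundary X] `*` `[0, tau R q])
    (fun u => sigma u.1.1 u.1.2 u.2).

Definition spectral_integrable (F : boundary X * R -> R[i]) : Prop :=
  cintegrable (nu \x plancherel X)%E
    ([set: boundary X] `*` `[0, tau R q]) F.

Definition spectral_integral (F : boundary X * R -> R[i]) : R[i] :=
  cintegral (nu \x plancherel X)%E
    ([set: boundary X] `*` `[0, tau R q]) F.

Definition pdo_integrand f x (u : boundary X * R) : R[i] :=
  plane_wave (- u.2) u.1 x * sigma x u.1 u.2 * fourier_helgason f u.1 u.2.

Definition pdo f : X -> R[i]^o :=
  fun x => spectral_integral (pdo_integrand f x).

Definition kernel_integrand x y (u : boundary X * R) : R[i] :=
  plane_wave (- u.2) u.1 x * plane_wave u.2 u.1 y * sigma x u.1 u.2.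

Definition pdo_nuclear (p1 p2 : \bar R) : Prop :=
  (forall f x, finitely_supported f ->
    spectral_integrable (pdo_integrand f x)) /\
  exists T : (X -> R[i]^o) -> (X -> R[i]^o),
    (forall f, finitely_supported f -> T f = pdo f) /\
    nuclear (lp_norm p1) (lp_norm p2) T.

End pseudo_differential.

(* Main.v *)
Require Import Defs.
From mathcomp Require Import all_boot all_order all_algebra complex.
From mathcomp Require Import all_classical all_reals all_analysis.
From mathcomp Require Import measurable_realfun finmap ring.

(* The operator is determined by its kernel
   [K x y = T_sigma (point_mass y) x], which is the spectral integral of the
   statement.  If [T = \sum_k x'_k y_k] is nuclear, evaluating at point masses
   gives [K x y = \sum_k y_k x * g_k y] with [g_k y = x'_k (point_mass y)], and
   by the duality of [l^p] and [l^p'] (tested on finitely supported functions)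
   the [l^p'] norm of [g_k] is at most the norm of [x'_k].  Conversely, given
   such a decomposition of [K], the series [\sum_k <h, g_k> f_k] defines a
   nuclear operator by Hoelder's inequality; it agrees with [T_sigma] on point
   masses, hence on all finitely supported functions. *)

Import Order.TTheory GRing.Theory Num.Theory.
Import numFieldNormedType.Exports.

Local Open Scope classical_set_scope.
Local Open Scope ring_scope.
Local Open Scope complex_scope.

(** * Modulus, real and imaginary parts, and convergence of complex sequences *)

Section complex_modulus.
Context {R : realType}.
Implicit Types z w : R[i].

Lemma normE_cmod z : `|z| = (cmod z)%:C.
Proof. by []. Qed.

Lemma cmod_ge0 z : 0 <= cmod z.
Proof. by rewrite -lecR -normE_cmod normr_ge0. Qed.

Lemma cmodM z w : cmod (z * w) = cmod z * cmod w.
Proof. exact: ComplexField.Normc.normcM. Qed.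

Lemma cmodV z : cmod z^-1 = (cmod z)^-1.
Proof. exact: ComplexField.Normc.normcV. Qed.

Lemma cmodN z : cmod (- z) = cmod z.
Proof. exact: normcN. Qed.

Lemma cmod0 : cmod (0 : R[i]) = 0.
Proof. exact: ComplexField.Normc.normc0. Qed.

Lemma cmod1 : cmod (1 : R[i]) = 1.
Proof. exact: ComplexField.Normc.normc1. Qed.

Lemma cmod_eq0 z : (cmod z == 0) = (z == 0).
Proof.
by apply/eqP/eqP => [|->]; [exact: ComplexField.Normc.eq0_normc|exact: cmod0].
Qed.

Lemma cmodD z w : cmod (z + w) <= cmod z + cmod w.
Proof. exact: le_normcD. Qed.

Lemma cmodR (r : R) : cmod r%:C = `|r|.
Proof. by rewrite /cmod /= expr0n /= addr0 sqrtr_sqr. Qed.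

Lemma Re_le_cmod z : `|complex.Re z| <= cmod z.
Proof. by rewrite -lecR; exact: normc_ge_Re. Qed.

Lemma Im_le_cmod z : `|complex.Im z| <= cmod z.
Proof.
case: z => a b /=; rewrite /cmod/= -[leLHS]sqrtr_sqr ler_wsqrtr//.
by rewrite lerDr sqr_ge0.
Qed.

Lemma cmod_le_ReIm z : cmod z <= `|complex.Re z| + `|complex.Im z|.
Proof.
case: z => a b; rewrite (_ : a +i* b = a%:C + (0 +i* b)).
  rewrite (le_trans (cmodD _ _))// cmodR /= /cmod /=.
  by rewrite expr0n /= add0r sqrtr_sqr addr0 add0r.
by apply/eqP; rewrite eq_complex /= !addr0 add0r !eqxx.
Qed.

Lemma ReM z w : complex.Re (z * w) =
  complex.Re z * complex.Re w - complex.Im z * complex.Im w.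
Proof. by case: z => a b; case: w. Qed.

Lemma ImM z w : complex.Im (z * w) =
  complex.Re z * complex.Im w + complex.Im z * complex.Re w.
Proof. by case: z => a b; case: w. Qed.

Lemma ReD z w : complex.Re (z + w) = complex.Re z + complex.Re w.
Proof. by case: z => a b; case: w. Qed.

Lemma ImD z w : complex.Im (z + w) = complex.Im z + complex.Im w.
Proof. by case: z => a b; case: w. Qed.

(** The norm of [R[i]] takes its values in [R[i]]; this passes to a real sequence, on which
    squeezing is available. *)
Lemma cvg_cmodP (u : nat -> R[i]^o) (l : R[i]^o) :
  u @ \oo --> l <-> (cmod (l - u n) : R) @[n --> \oo] --> (0 : R).
Proof.
split=> [/cvgrPdist_lt ul|/cvgrPdist_lt ul].
  apply/cvgrPdist_lt => e e0.
  have := ul e%:C; rewrite ltcR => /(_ e0); apply: filterS => n.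
  by rewrite normE_cmod ltcR sub0r normrN ger0_norm// cmod_ge0.
(* A positive element of [R[i]] has zero imaginary part, so its real part serves as the
   tolerance. *)
apply/cvgrPdist_lt => -[e e']; rewrite ltcE /= => /andP[/eqP -> e0].
have := ul e e0; apply: filterS => n.
by rewrite sub0r normrN ger0_norm ?cmod_ge0// normE_cmod -ltcR.
Qed.

Lemma cvg_ReIm (u : nat -> R[i]^o) (l : R[i]^o) :
  complex.Re (u n) @[n --> \oo] --> complex.Re l ->
  complex.Im (u n) @[n --> \oo] --> complex.Im l -> u @ \oo --> l.
Proof.
move=> uRe uIm; apply/cvg_cmodP.
apply: (@squeeze_cvgr _ _ _ _ (fun=> 0)
  (fun n => `|complex.Re l - complex.Re (u n)| +
            `|complex.Im l - complex.Im (u n)|)).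
- apply: nearW => n; rewrite cmod_ge0 /= (le_trans (cmod_le_ReIm _))//.
  by rewrite ReD ImD; case: (u n).
- exact: cvg_cst.
- rewrite -[0]addr0; apply: cvgD; rewrite -(@normr0 R R); apply: cvg_norm.
  + by rewrite -(subrr (complex.Re l)); apply: cvgB => //; exact: cvg_cst.
  + by rewrite -(subrr (complex.Im l)); apply: cvgB => //; exact: cvg_cst.
Qed.

Lemma cvg_cmod (u : nat -> R[i]^o) (l : R[i]^o) :
  u @ \oo --> l -> cmod (u n) @[n --> \oo] --> cmod l.
Proof.
move=> /cvg_cmodP/cvgrPdistC_lt ul; apply/cvgrPdistC_lt => e /ul.
apply: filterS => n.
rewrite subr0 ger0_norm ?cmod_ge0// => /(le_lt_trans _); apply.
rewrite ler_distlC; apply/andP; split.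
  rewrite lerBlDr addrC -{1}(subrK l (u n)) (le_trans (cmodD _ _))//.
  by rewrite -opprB cmodN.
by rewrite addrC -{1}(subrK (u n) l) cmodD.
Qed.

(* [R[i]] has no [completeType] instance, hence the detour through real and
   imaginary parts. *)
Lemma cmod_summable_cvg (u : nat -> R[i]^o) :
  (\sum_(n <oo) (cmod (u n))%:E < +oo)%E -> cvgn (series u).
Proof.
move=> uoo.
(* [f] stands for [Re] and for [Im]: additivity and the bound by the modulus suffice to make the
   image series absolutely convergent. *)
have cv (f : R[i] -> R) : (forall z w, f (z + w) = f z + f w) ->
    (forall z, `|f z| <= cmod z) ->
    exists l : R, f (series u n) @[n --> \oo] --> l.
  move=> fD fle.
  have f0 : f 0 = 0.
    by apply/eqP; rewrite -normr_le0 -cmod0; exact: fle.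
  have : cvgn (series (f \o u)).
    apply: normed_cvg; apply: nondecreasing_is_cvgn.
      by apply: nondecreasing_series => n _ _; exact: normr_ge0.
    exists (fine (\sum_(n <oo) (cmod (u n))%:E)) => _ [n _ <-] /=.
    rewrite -lee_fin fineK; last first.
      rewrite ge0_fin_numE// nneseries_ge0// => k _ _.
      by rewrite lee_fin cmod_ge0.
    rewrite (le_trans _ (nneseries_lim_ge n _))//; last first.
      by move=> k _ _; rewrite lee_fin cmod_ge0.
    by rewrite sumEFin lee_fin; apply: ler_sum => k _; exact: fle.
  move=> /cvg_ex[l ul]; exists l; apply: cvg_trans ul.
  apply: near_eq_cvg; apply: nearW => n; rewrite /series /=.
  elim: n => [|n IHn]; first by rewrite !big_geq ?f0.
  by rewrite !big_nat_recr//= fD -IHn.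
have [a ua] := cv _ ReD Re_le_cmod.
have [b ub] := cv _ ImD Im_le_cmod.
by apply/cvg_ex; exists (a +i* b); exact: cvg_ReIm.
Qed.

End complex_modulus.

(** * Absolutely convergent integrals of complex functions *)

Section complex_integral.
Context {R : realType} {d} {T : measurableType d}.
Context {mu : {measure set T -> \bar R}} {D : set T} (mD : measurable D).
Implicit Types F G : T -> R[i].

Lemma measurable_cmod F : measurable_fun D (fun t => complex.Re (F t)) ->
  measurable_fun D (fun t => complex.Im (F t)) ->
  measurable_fun D (fun t => cmod (F t)).
Proof.
move=> mRe mIm; rewrite (_ : (fun t => _) =
    (fun t => Num.sqrt (complex.Re (F t) ^+ 2 + complex.Im (F t) ^+ 2))).
  apply: (@measurableT_comp _ _ _ _ _ _ (@Num.sqrt R)).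
    by apply: continuous_measurable_fun; exact: sqrt_continuous.
  by apply: measurable_funD; apply: measurable_funX.
by apply/funext => t; case: (F t).
Qed.

(** Both directions come from [|Re|, |Im| <= cmod <= |Re| + |Im|]. Linearity of the complex integral
    is then inherited from the real one. *)
Lemma cintegrableE F : cintegrable mu D F <->
  mu.-integrable D (EFin \o (fun t => complex.Re (F t))) /\
  mu.-integrable D (EFin \o (fun t => complex.Im (F t))).
Proof.
split=> [[[mRe mIm] Foo]|[/[dup] iRe /integrableP[mRe Reoo]
                          /[dup] iIm /integrableP[mIm Imoo]]].
  have /measurable_EFinP mc := measurable_cmod F mRe mIm.
  split; apply/integrableP; split.
  - exact/measurable_EFinP.
  - apply: le_lt_trans Foo; apply: ge0_le_integral => //=.
    + by do 2 apply: measurableT_comp => //.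
    + by move=> t _; rewrite lee_fin Re_le_cmod.
  - exact/measurable_EFinP.
  - apply: le_lt_trans Foo; apply: ge0_le_integral => //=.
    + by do 2 apply: measurableT_comp => //.
    + by move=> t _; rewrite lee_fin Im_le_cmod.
move/measurable_EFinP in mRe; move/measurable_EFinP in mIm.
split => //.
have /measurable_EFinP mc := measurable_cmod F mRe mIm.
apply: le_lt_trans (lte_add_pinfty Reoo Imoo).
rewrite -ge0_integralD//=; last 2 first.
- by do 2 apply: measurableT_comp => //.
- by do 2 apply: measurableT_comp => //.
apply: ge0_le_integral => //=.
- by move=> t _; rewrite lee_fin cmod_ge0.
- by apply: emeasurable_funD; do 2 apply: measurableT_comp => //.
- by move=> t _; rewrite -EFinD lee_fin cmod_le_ReIm.
Qed.

Lemma cintegrable0 : cintegrable mu D (fun=> 0).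
Proof.
by apply/cintegrableE; split; exact: integrable0.
Qed.

Lemma cintegrableD F G : cintegrable mu D F -> cintegrable mu D G ->
  cintegrable mu D (fun t => F t + G t).
Proof.
move=> /cintegrableE[FRe FIm] /cintegrableE[GRe GIm].
apply/cintegrableE; split.
  under [_ \o _]eq_fun do rewrite ReD; exact: (integrableD mD FRe GRe).
under [_ \o _]eq_fun do rewrite ImD; exact: (integrableD mD FIm GIm).
Qed.

Lemma cintegrableZ a F : cintegrable mu D F ->
  cintegrable mu D (fun t => a * F t).
Proof.
move=> /cintegrableE[FRe FIm]; apply/cintegrableE; split.
  under [_ \o _]eq_fun do rewrite ReM.
  exact: (integrableB mD (integrableZl mD _ FRe) (integrableZl mD _ FIm)).
under [_ \o _]eq_fun do rewrite ImM.
exact: (integrableD mD (integrableZl mD _ FIm) (integrableZl mD _ FRe)).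
Qed.

Lemma cintegralD F G : cintegrable mu D F -> cintegrable mu D G ->
  cintegral mu D (fun t => F t + G t) = cintegral mu D F + cintegral mu D G.
Proof.
move=> /cintegrableE[FRe FIm] /cintegrableE[GRe GIm]; rewrite /cintegral.
under eq_Rintegral do rewrite ReD; rewrite RintegralD//.
by under [X in _ +i* X = _]eq_Rintegral do rewrite ImD; rewrite RintegralD.
Qed.

Lemma cintegralZ a F : cintegrable mu D F ->
  cintegral mu D (fun t => a * F t) = a * cintegral mu D F.
Proof.
move=> /cintegrableE[FRe FIm]; apply/eqP; rewrite eq_complex ReM ImM /=.
have Zl b f : mu.-integrable D (EFin \o f) ->
  mu.-integrable D (EFin \o (fun t => b * f t)).
  by move=> fi; exact: (integrableZl mD b fi).
apply/andP; split; apply/eqP.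
  under eq_Rintegral do rewrite ReM.
  by rewrite RintegralB ?RintegralZl//; exact: Zl.
under eq_Rintegral do rewrite ImM.
by rewrite RintegralD ?RintegralZl//; exact: Zl.
Qed.

Lemma cintegrable_sum (I : Type) (s : seq I) (F : I -> T -> R[i]) :
  (forall i, cintegrable mu D (F i)) ->
  cintegrable mu D (fun t => \sum_(i <- s) F i t).
Proof.
move=> iF; elim: s => [|i s IHs].
  by under eq_fun do rewrite big_nil; exact: cintegrable0.
by under eq_fun do rewrite big_cons; exact: cintegrableD.
Qed.

Lemma cintegral_sum (I : Type) (s : seq I) (F : I -> T -> R[i]) :
  (forall i, cintegrable mu D (F i)) ->
  cintegral mu D (fun t => \sum_(i <- s) F i t) =
  \sum_(i <- s) cintegral mu D (F i).
Proof.
move=> iF; elim: s => [|i s IHs].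
  rewrite big_nil; under eq_fun do rewrite big_nil.
  by rewrite /cintegral/= /Rintegral integral0.
rewrite big_cons -IHs -cintegralD//; last exact: cintegrable_sum.
by congr cintegral; apply/funext => t; rewrite big_cons.
Qed.

(* Rotate the integral to the positive real axis. *)
Lemma cmod_cintegral_le F : cintegrable mu D F ->
  ((cmod (cintegral mu D F))%:E <= \int[mu]_(t in D) (cmod (F t))%:E)%E.
Proof.
move=> iF; set I := cintegral mu D F.
have [->|I0] := eqVneq I 0.
  by rewrite cmod0 integral_ge0// => t _; rewrite lee_fin cmod_ge0.
pose a := (cmod I)%:C / I.
have cI0 : cmod I != 0 by rewrite cmod_eq0.
have ca : cmod a = 1.
  by rewrite cmodM cmodV cmodR ger0_norm ?cmod_ge0// divff.
have iaF := cintegrableZ a _ iF.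
have aFE : \int[mu]_(t in D) complex.Re (a * F t) = cmod I.
  by have /(congr1 (@complex.Re R)) := cintegralZ a _ iF; rewrite /a -/I divfK.
have [iRe _] := (cintegrableE _).1 iaF.
have <- : `|\int[mu]_(t in D) complex.Re (a * F t)| = cmod I.
  by rewrite aFE ger0_norm ?cmod_ge0.
rewrite (EFin_normr_Rintegral mD iRe) (le_trans (le_abse_integral mu mD _))//.
  by case/integrableP : iRe.
apply: ge0_le_integral => //=.
- apply: measurableT_comp => //; apply: measurableT_comp => //.
  by apply/measurable_EFinP; case/integrableP : iRe.
- by apply/measurable_EFinP; case: iF => -[mRe mIm] _; exact: measurable_cmod.
- by move=> t _; rewrite lee_fin -[cmod (F t)]mul1r -ca -cmodM Re_le_cmod.
Qed.

End complex_integral.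

(** * Measurability and countability of the vertex set *)

Section vertices.
Context (q : nat) (X : htree q).

(** The vertices carry the discrete sigma-algebra, so the claim holds by computation. *)
Lemma measurable_vertex d (T : measurableType d) (D : set X) (f : X -> T) :
  measurable_fun D f.
Proof. by []. Qed.

Lemma finite_neighbours (x : X) : finite_set [set y | adj x y].
Proof. by exists q.+1; exact: adj_regular. Qed.

(** The endpoints of walks of length [n] from the root form a finite set, by induction on [n] and
    finiteness of the degree; by connectedness these sets cover the tree. *)
Lemma countable_vertex : countable [set: X].
Proof.
have fin n : finite_set [set y | walk (Defs.root X : X) y n].
  elim: n => [|n IHn].
    apply: (@sub_finite_set _ _ [set Defs.root X]) => // y /=.
    by move=> /asboolP[[|a p] []].
  apply: sub_finite_set (bigcup_finite IHn (fun x _ => finite_neighbours x)).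
  move=> y /= /asboolP[p []]; case/lastP: p => // p z.
  rewrite rcons_path last_rcons size_rcons => /andP[pp pz] zy [sp].
  exists (last (Defs.root X) p); last by rewrite /= -zy.
  by apply/asboolP; exists p.
apply: sub_countable (bigcup_countable (countableP [set: nat])
  (fun n _ => finite_set_countable (fin n))).
apply: subset_card_le => y _; have [n yn] := walk_exists (Defs.root X : X) y.
by exists n.
Qed.

End vertices.

(** * Integrals against counting measure as sums *)

Section counting_integral.
Context {R : realType} {q : nat} {X : htree q}.
Local Open Scope ereal_scope.
Local Notation mu := (@counting X R).

Lemma counting_set1 (x : X) : mu [set x] = 1.
Proof. by rewrite /counting asboolT// fset_set1 cardfs1. Qed.

(** Such an [f] is a finite combination of indicators of singletons, each of mass 1. *)
Lemma integral_counting_seq (f : X -> \bar R) (s : seq X) : uniq s ->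
  (forall x, 0 <= f x) -> (forall x, x \notin s -> f x = 0) ->
  \int[mu]_x f x = \sum_(x <- s) f x.
Proof.
move=> us f0 fs.
transitivity (\int[mu]_x \sum_(y <- s) (f y * (\1_[set y] x)%:E)).
  apply: eq_integral => x _; have [xs|xs] := boolP (x \in s).
    rewrite (bigD1_seq x)//= big1 ?adde0.
      by rewrite indicE mem_set// mule1.
    move=> y yx; rewrite indicE memNset ?mule0//= => xy.
    by move: yx; rewrite xy eqxx.
  rewrite fs// big1_seq// => y /andP[_ ys].
  rewrite indicE memNset ?mule0//= => xy.
  by move: xs; rewrite xy ys.
rewrite ge0_integral_sum//.
  apply: eq_bigr => y _; rewrite ge0_integralZl//.
  by rewrite integral_indic// setIT /= counting_set1 mule1.
by move=> y x _; rewrite mule_ge0// lee_fin.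
Qed.

(** With the vertices numbered injectively by [e], the restrictions [g n] of [f] to the finite sets
    [e x < n] increase to [f], and monotone convergence applies. *)
Lemma integral_counting_le (f : X -> \bar R) (M : \bar R) :
  (forall x, 0 <= f x) ->
  (forall s, uniq s -> \sum_(x <- s) f x <= M) -> \int[mu]_x f x <= M.
Proof.
move=> f0 fM; have /countable_injP[e inje] := countable_vertex q X.
pose g n x := if (e x < n)%N then f x else 0.
have gf x : limn (g ^~ x) = f x.
  apply: lim_near_cst => //; exists (e x).+1 => // n /= en.
  by rewrite /g en.
rewrite -(eq_integral _ _ (fun x _ => gf x)).
have g0 n x : 0 <= g n x by rewrite /g; case: ifP.
have ndg x : nondecreasing_seq (g ^~ x).
  move=> m n mn; rewrite /g; case: ifPn => [em|_]; last exact: g0.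
  by rewrite (leq_trans em mn).
have /cvg_lim <- // 
  := cvg_monotone_convergence (mu := mu : measure X R) measurableT
  (fun n => measurable_vertex q X _ _ setT (g n))
  (fun n x _ => g0 n x) (fun x _ => ndg x).
apply: lime_le.
  apply: ereal_nondecreasing_is_cvgn => m n mn.
  by apply: ge0_le_integral => // x _; exact: ndg.
apply: nearW => n.
have fin : finite_set [set x | (e x < n)%N].
  apply: (@finite_preimage _ _ `I_n e) => //.
  by move=> x y _ _; apply: inje; exact: mem_set.
rewrite (integral_counting_seq _ (fset_set [set x | (e x < n)%N])) ?fset_uniq//.
  rewrite (le_trans _ (fM (fset_set [set x | (e x < n)%N]) (fset_uniq _)))//.
  by apply: lee_sum => x _; rewrite /g; case: ifP.
by move=> x; rewrite in_fset_set// notin_setE /= /g => /negP/negPf ->.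
Qed.

End counting_integral.

(** * Real powers and conjugate exponents *)

Section powers.
Context {R : realType}.
Implicit Types p : R.
Local Open Scope ereal_scope.

(** Reduces a comparison of norms to one of their [p]-th powers, which are integrals; infinite
    values are allowed. *)
Lemma poweR_le (a b : \bar R) p : (0 < p)%R -> 0 <= a -> 0 <= b ->
  (a `^ p <= b `^ p) = (a <= b).
Proof.
have inpos c : 0 <= c -> (c : \bar R) \in `[0, +oo].
  by rewrite in_itv/= leey andbT.
move=> p0 a0 b0; apply/idP/idP => [|ab].
  move=> /(gt0_ler_poweR (r := p^-1)); rewrite -!poweRrM mulfV ?gt_eqF//.
  by rewrite !poweRe1//; apply; rewrite ?invr_ge0 ?(ltW p0)// inpos// poweR_ge0.
by apply: gt0_ler_poweR ab; rewrite ?(ltW p0)// inpos.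
Qed.

Lemma cvg_powR (u : nat -> R) (l p : R) : (0 < p)%R ->
  (forall n, 0 <= u n)%R -> u @ \oo --> l ->
  (u n `^ p)%R @[n --> \oo] --> (l `^ p)%R.
Proof.
move=> p0 u0 ul; have l0 : (0 <= l)%R.
  rewrite -(cvg_lim _ ul)//; apply: limr_ge; last exact: nearW.
  by apply/cvg_ex; exists l.
(* Continuity comes from differentiability, which is available at positive points only; at the limit
   0 the [p]-th root of the tolerance is used instead. *)
have [lE|ln0] := eqVneq l 0%R.
  rewrite lE powR0 ?gt_eqF//; apply/cvgrPdist_lt => e e0.
  have e'0 : (0 < e `^ p^-1)%R by rewrite powR_gt0.
  move/cvgrPdist_lt : ul => /(_ _ e'0); apply: filterS => n.
  rewrite lE !sub0r !normrN !ger0_norm ?powR_ge0// => une.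
  have -> : e = ((e `^ p^-1) `^ p)%R.
    by rewrite -powRrM mulVf ?gt_eqF// powRr1// ltW.
  by rewrite gt0_ltr_powR ?nnegrE ?powR_ge0.
have lgt0 : (0 < l)%R by rewrite lt_def ln0.
have /derivable1_diffP/differentiable_continuous c :
    derivable (fun t : R => t `^ p)%R l 1%R.
  by apply: derivable_powR; rewrite in_itv/= lgt0.
exact: (cvg_comp _ _ ul c).
Qed.

Lemma hoelder_conjugate_gt1 p : (1 < p)%R ->
  hoelder_conjugate p%:E = (p / (p - 1))%:E.
Proof.
move=> p1; rewrite /hoelder_conjugate/= eqe gt_eqF ?(lt_trans ltr01)//.
by rewrite inver subr_eq0 gt_eqF.
Qed.

End powers.

(** * The norms of the spaces [l^p] on the tree: Minkowski, Fatou, Hoelder *)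

Section lp.
Context {R : realType} {q : nat} {X : htree q}.
Implicit Types (f g h : X -> R[i]^o) (p : R) (x y : X).
Local Open Scope ereal_scope.
Local Notation mu := (@counting X R).

Lemma lp_norm_ge0 (p : \bar R) f : 0 <= lp_norm p f.
Proof. exact: Lnorm_ge0. Qed.

Lemma poweR_lp_norm p f : (1 <= p)%R ->
  lp_norm p%:E f `^ p = \int[mu]_x (cmod (f x) `^ p)%:E.
Proof.
move=> p1; rewrite /lp_norm poweR_Lnorm ?gt_eqF ?(lt_le_trans ltr01)//.
by apply: eq_integral => x _; rewrite gee0_abs ?lee_fin ?cmod_ge0.
Qed.

Lemma poweR_lp_norm_seq p f (s : seq X) : (1 <= p)%R -> uniq s ->
  (forall x, x \notin s -> f x = 0%R) ->
  lp_norm p%:E f `^ p = (\sum_(x <- s) cmod (f x) `^ p)%:E.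
Proof.
move=> p1 us fs; rewrite poweR_lp_norm// (integral_counting_seq _ s)//.
- by rewrite sumEFin.
- by move=> x; rewrite lee_fin powR_ge0.
- by move=> x /fs ->; rewrite cmod0 powR0// gt_eqF// (lt_le_trans ltr01).
Qed.

Lemma lp_norm_seq p f (s : seq X) : (1 <= p)%R -> uniq s ->
  (forall x, x \notin s -> f x = 0%R) ->
  lp_norm p%:E f = ((\sum_(x <- s) cmod (f x) `^ p) `^ p^-1)%:E.
Proof.
move=> p1 us fs; have p0 : p != 0%R by rewrite gt_eqF// (lt_le_trans ltr01).
rewrite -poweR_EFin -(poweR_lp_norm_seq _ _ s p1 us fs) -poweRrM mulfV//.
by rewrite poweRe1// lp_norm_ge0.
Qed.

(** In the integral of the [p]-th powers only the term at [x] is kept. This is how convergence in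
    norm yields convergence at each vertex. *)
Lemma cmod_le_lp_norm p f x : (1 <= p)%R -> (cmod (f x))%:E <= lp_norm p%:E f.
Proof.
move=> p1; have p0 : (0 < p)%R by rewrite (lt_le_trans ltr01).
rewrite -(poweR_le _ _ p)// ?lee_fin ?cmod_ge0 ?lp_norm_ge0//.
rewrite poweR_lp_norm// poweR_EFin.
rewrite (le_trans (y :=
  \int[mu]_y (if y == x then cmod (f x) `^ p else 0)%:E))//.
  rewrite (integral_counting_seq _ [:: x])//.
  - by rewrite big_seq1 eqxx.
  - by move=> y; rewrite lee_fin; case: ifP => // _; exact: powR_ge0.
  - by move=> y; rewrite inE => /negPf ->.
by apply: ge0_le_integral => // y _; rewrite lee_fin; case: (y =P x) => [yx|_];
  rewrite ?yx ?powR_ge0.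
Qed.

Lemma lp_norm_le p f g : (1 <= p)%R -> (forall x, cmod (f x) <= cmod (g x))%R ->
  lp_norm p%:E f <= lp_norm p%:E g.
Proof.
move=> p1 fg; have p0 : (0 < p)%R by rewrite (lt_le_trans ltr01).
rewrite -(poweR_le _ _ p)// ?lp_norm_ge0// !poweR_lp_norm//.
apply: ge0_le_integral => //= x _; rewrite lee_fin ?powR_ge0//.
by rewrite ge0_ler_powR ?nnegrE ?cmod_ge0// ltW.
Qed.

Lemma lp_normZ p f (a : R[i]) : (1 <= p)%R ->
  lp_norm p%:E (a *: f)%R = (cmod a)%:E * lp_norm p%:E f.
Proof.
move=> p1; have p0 : (0 < p)%R by rewrite (lt_le_trans ltr01).
have c0 : 0 <= (cmod a)%:E by rewrite lee_fin cmod_ge0.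
have E : lp_norm p%:E (a *: f)%R `^ p = ((cmod a)%:E * lp_norm p%:E f) `^ p.
  rewrite poweRM ?lp_norm_ge0// !poweR_lp_norm// poweR_EFin.
  rewrite -ge0_integralZl ?lee_fin ?powR_ge0//; last first.
    by move=> x _; rewrite lee_fin powR_ge0.
  apply: eq_integral => x _; rewrite -EFinM /= cmodM.
  by rewrite powRM ?cmod_ge0.
have h := (lp_norm_ge0 p%:E (a *: f)%R, mule_ge0 c0 (lp_norm_ge0 p%:E f)).
apply/eqP; rewrite eq_le.
by apply/andP; split; rewrite -(poweR_le _ _ p) ?h// E.
Qed.

Lemma lp_normD p f g : (1 <= p)%R ->
  lp_norm p%:E (f + g)%R <= lp_norm p%:E f + lp_norm p%:E g.
Proof.
(* Minkowski's inequality is applied to the real functions [cmod (f x)] and [cmod (g x)], whose sum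
   [fg] dominates [f + g] pointwise. *)
move=> p1.
pose fg x : R[i]^o := (cmod (f x) + cmod (g x))%:C.
apply: (@le_trans _ _ (lp_norm p%:E fg)).
  apply: lp_norm_le => // x; rewrite /fg cmodR ger0_norm ?cmodD//.
  by rewrite addr_ge0 ?cmod_ge0.
rewrite /lp_norm [leLHS](_ : _ = Lnorm mu p%:E
    (EFin \o ((fun x => cmod (f x)) \+ (fun x => cmod (g x))))%R).
  exact: eminkowski.
apply: eq_Lnorm => x; congr EFin; rewrite /fg cmodR ger0_norm//.
by rewrite addr_ge0 ?cmod_ge0.
Qed.

Lemma lp_norm0 p : (1 <= p)%R -> lp_norm p%:E (0%R : X -> R[i]^o) = 0.
Proof.
by move=> p1; rewrite -(scale0r (0%R : X -> R[i]^o)) lp_normZ// cmod0 mul0e.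
Qed.

Lemma lp_norm_sum p (I : Type) (s : seq I) (F : I -> X -> R[i]^o) :
  (1 <= p)%R ->
  lp_norm p%:E (\sum_(i <- s) F i)%R <= \sum_(i <- s) lp_norm p%:E (F i).
Proof.
move=> p1; elim: s => [|i s IHs]; first by rewrite !big_nil lp_norm0.
by rewrite !big_cons (le_trans (lp_normD _ _ _ p1))// leeD2l.
Qed.

(** Fatou's lemma for the [p]-th powers of the moduli, whose lower limit is a true limit. It carries
    bounds on partial sums over to the sum of a pointwise convergent series. *)
Lemma lp_norm_fatou p (u : nat -> X -> R[i]^o) f (M : \bar R) : (1 <= p)%R ->
  (forall x, u n x @[n --> \oo] --> f x) ->
  (forall n, lp_norm p%:E (u n) <= M) -> lp_norm p%:E f <= M.
Proof.
move=> p1 uf uM; have p0 : (0 < p)%R by rewrite (lt_le_trans ltr01).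
have M0 : 0 <= M by rewrite (le_trans _ (uM 0%N))// lp_norm_ge0.
rewrite -(poweR_le _ _ p)// ?lp_norm_ge0// poweR_lp_norm//.
pose F n x := (cmod (u n x) `^ p)%:E.
have FE x : limn_einf (F ^~ x) = (cmod (f x) `^ p)%:E.
  have Fx : F n x @[n --> \oo] --> (cmod (f x) `^ p)%:E.
    apply: cvg_EFin; first exact: nearW.
    apply: cvg_powR => //; first by move=> n; exact: cmod_ge0.
    exact/cvg_cmod/uf.
  rewrite is_cvg_limn_einfE ?(cvg_lim _ Fx)//.
rewrite -(eq_integral _ _ (fun x _ => FE x)).
have F0 n x : 0 <= F n x by rewrite lee_fin powR_ge0.
have := @fatou _ X R (mu : measure X R) setT measurableT F
  (fun n => measurable_vertex q X _ _ setT (F n)) (fun n x _ => F0 n x).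
move=> /le_trans; apply; rewrite limn_einf_lim.
apply: lime_le; first exact: is_cvg_einfs.
apply: nearW => n; apply: (@le_trans _ _ (\int[mu]_x F n x)).
  by apply: ereal_inf_lbound; exists n => /=.
by rewrite -poweR_lp_norm// poweR_le// lp_norm_ge0.
Qed.

(** The essential supremum is a true supremum here: every vertex has mass 1, so a null set contains
    none. *)
Lemma cmod_le_lp_normy g x : (cmod (g x))%:E <= lp_norm +oo g.
Proof.
have mu0 : 0 < mu setT.
  rewrite (@lt_le_trans _ _ (mu [set x]))//.
    by rewrite counting_set1 lte01.
  by apply: le_measure => //; exact: mem_set.
rewrite /lp_norm unlock mu0.
have [N [_ N0 sub]] := ess_sup_inf.ess_sup_ge (mu : measure X R)
  (abse \o (fun x => (cmod (g x))%:E)).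
rewrite -[leLHS]gee0_abs ?lee_fin ?cmod_ge0//.
apply: contrapT => xN; have : mu [set x] <= mu N.
  by apply: le_measure; [exact: mem_set|exact: mem_set|move=> _ ->; exact: sub].
by rewrite N0 counting_set1 leNgt lte01.
Qed.

Lemma lp_normy_le g (M : \bar R) : 0 <= M ->
  (forall x, (cmod (g x))%:E <= M) -> lp_norm +oo g <= M.
Proof.
move=> M0 gM; rewrite /lp_norm unlock; case: ifP => // _.
apply/ess_sup_inf.ess_supP; apply: aeW => x /=.
by rewrite ger0_norm ?cmod_ge0 ?gM.
Qed.

Lemma lp_hoelder p h g : (1 <= p)%R ->
  \int[mu]_x (cmod (h x * g x))%:E <=
    lp_norm p%:E h * lp_norm (hoelder_conjugate p%:E) g.
Proof.
move=> p1; have p0 : (0 < p)%R by rewrite (lt_le_trans ltr01).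
(* At [p = 1] the conjugate exponent is [+oo], and [g] is bounded pointwise by its norm. *)
have [pE|pn1] := eqVneq p 1%R.
  rewrite pE hoelder_conjugate1 /lp_norm Lnorm1 -/(lp_norm _ _).
  rewrite muleC -ge0_integralZl//; last exact: lp_norm_ge0.
  apply: ge0_le_integral => //= x _.
  - by rewrite lee_fin cmod_ge0.
  - rewrite cmodM EFinM muleC ger0_norm ?cmod_ge0//.
    by rewrite lee_wpmul2r ?lee_fin ?cmod_ge0// cmod_le_lp_normy.
have pgt1 : (1 < p)%R by rewrite lt_neqAle eq_sym pn1.
pose p' := (p / (p - 1))%R.
have p'E : hoelder_conjugate p%:E = p'%:E by exact: hoelder_conjugate_gt1.
have := @hoelder _ _ _ mu (fun x => cmod (h x)) (fun x => cmod (g x)) p p'.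
rewrite -p'E Lnorm1 => H; apply: le_trans (H _ _ _ _ _) => //.
- apply: ge0_le_integral => //= x _; rewrite ?lee_fin ?cmod_ge0//.
  by rewrite cmodM ler_norm.
- by rewrite divr_gt0// subr_gt0.
- by rewrite invf_div -{1}(div1r p) -mulrDl subrKC mulfV// gt_eqF.
Qed.

End lp.

(** * Point masses and linear maps on their finite combinations *)

Section point_masses.
Context {R : realType} {q : nat} {X : htree q}.
Implicit Types (f h : X -> R[i]^o) (p : R) (x y : X) (s : seq X).

Definition point_mass y : X -> R[i]^o := fun x => (x == y)%:R.

Lemma lp_norm_point_mass p y : 1 <= p -> lp_norm p%:E (point_mass y) = 1%E.
Proof.
move=> p1; rewrite (lp_norm_seq _ _ [:: y])//.
  by rewrite big_seq1 /point_mass eqxx cmod1 !powR1.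
by move=> x; rewrite inE /point_mass => /negPf ->.
Qed.

Lemma point_mass_fin p y : 1 <= p -> fin_norm (lp_norm p%:E) (point_mass y).
Proof. by move=> p1; rewrite /fin_norm /= lp_norm_point_mass// ltry. Qed.

Lemma point_mass_sum_apply s (a : X -> R[i]) x : uniq s ->
  (\sum_(y <- s) a y *: point_mass y) x = if x \in s then a x else 0.
Proof.
move=> us; rewrite fct_sumE; case: ifPn => xs.
  rewrite (bigD1_seq x)//= big1 ?addr0.
    by rewrite /point_mass fctE eqxx /GRing.scale /= mulr1.
  by move=> y yx; rewrite fctE /point_mass eq_sym (negPf yx) scaler0.
rewrite big1_seq// => y /andP[_ ys].
rewrite fctE /point_mass; case: eqP => [xy|_]; last by rewrite scaler0.
by rewrite xy ys in xs.
Qed.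

Lemma point_mass_sumE f s : uniq s -> (forall x, x \notin s -> f x = 0) ->
  f = \sum_(y <- s) f y *: point_mass y.
Proof.
move=> us fs; apply/funext => x; rewrite point_mass_sum_apply//.
by case: ifPn => // /fs.
Qed.

Lemma fin_normZ p (a : R[i]) h : 1 <= p -> fin_norm (lp_norm p%:E) h ->
  fin_norm (lp_norm p%:E) (a *: h).
Proof.
move=> p1; rewrite /fin_norm /= lp_normZ// => hoo.
have := lp_norm_ge0 p%:E h; move: hoo; case: (lp_norm _ _) => // r _ _.
by rewrite -EFinM ltry.
Qed.

Lemma fin_norm_sum p s (a : X -> R[i]) : 1 <= p ->
  fin_norm (lp_norm p%:E) (\sum_(y <- s) a y *: point_mass y).
Proof.
move=> p1; rewrite /fin_norm /= (le_lt_trans (lp_norm_sum _ _ _ _ p1))//.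
apply: lte_sum_pinfty => y _; apply: fin_normZ => //; exact: point_mass_fin.
Qed.

Section linear_on_finite_norm.
Context {F : lmodType R[i]} (NF : F -> \bar R) (p : R) (T : (X -> R[i]^o) -> F).
Hypotheses (p1 : 1 <= p) (bT : bounded_linear (lp_norm p%:E) NF T).

(** Linearity is assumed on vectors of finite norm only; with [a = 1] and both vectors zero it gives
    [T 0 + T 0 = T 0]. *)
Lemma bounded_linear0 : T 0 = 0.
Proof.
have f0 : fin_norm (lp_norm p%:E) (0 : X -> R[i]^o).
  by rewrite /fin_norm /= lp_norm0.
apply: (addrI (T 0)); rewrite addr0 -{1}[T 0]scale1r -bT.1//.
by rewrite scale1r addr0.
Qed.

Lemma bounded_linearZ (a : R[i]) h : fin_norm (lp_norm p%:E) h ->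
  T (a *: h) = a *: T h.
Proof.
move=> hoo; rewrite -[a *: h]addr0 bT.1// ?bounded_linear0 ?addr0//.
by rewrite /fin_norm /= lp_norm0.
Qed.

Lemma bounded_linear_sum s (a : X -> R[i]) :
  T (\sum_(y <- s) a y *: point_mass y) = \sum_(y <- s) a y *: T (point_mass y).
Proof.
elim: s => [|y s IHs]; first by rewrite !big_nil bounded_linear0.
rewrite !big_cons bT.1 ?IHs//; first exact: point_mass_fin.
exact: fin_norm_sum.
Qed.

End linear_on_finite_norm.

(** * Bounded functionals on [l^p] and the [l^p'] norm of their coefficients *)

Section functionals.
Context (p : R) (phi : (X -> R[i]^o) -> R[i]^o).
Hypotheses (p1 : 1 <= p) (bphi : bounded_linear (lp_norm p%:E) (@cabs R) phi).

Local Notation norm := (op_norm (lp_norm p%:E) (@cabs R) phi).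

Lemma op_norm_ge0 : (0 <= norm)%E.
Proof.
apply: ereal_sup_ubound; exists 0; first by rewrite /= lp_norm0.
by rewrite (bounded_linear0 _ _ _ p1 bphi) /cabs cmod0.
Qed.

Lemma op_norm_lty : (norm < +oo)%E.
Proof.
have [M bM] := bphi.2; apply: (@le_lt_trans _ _ `|M|%:E); last exact: ltry.
apply: ge_ereal_sup => _ [h /= h1 <-].
rewrite (le_trans (bM _ _)) ?/fin_norm /= ?(le_lt_trans h1) ?ltry//.
rewrite (@le_trans _ _ (`|M|%:E * lp_norm p%:E h)%E)//.
  by apply: lee_wpmul2r; [exact: lp_norm_ge0|rewrite lee_fin ler_norm].
by rewrite -[leRHS]mule1 lee_wpmul2l// lee_fin.
Qed.

(** The operator norm sees the unit ball only, so [h] is divided by its norm; when that norm is 0,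
    boundedness gives the claim directly. *)
Lemma cabs_le_op_norm h : fin_norm (lp_norm p%:E) h ->
  (cabs (phi h) <= norm * lp_norm p%:E h)%E.
Proof.
move=> hoo; have [h0|hn0] := eqVneq (lp_norm p%:E h) 0%E.
  by have [M bM] := bphi.2; rewrite (le_trans (bM _ hoo))// h0 !mule0.
have hE : lp_norm p%:E h = (fine (lp_norm p%:E h))%:E.
  by rewrite fineK// ge0_fin_numE// lp_norm_ge0.
have h0 : 0 < fine (lp_norm p%:E h).
  by rewrite fine_gt0// lt0e hn0 lp_norm_ge0.
set r := fine (lp_norm p%:E h) in hE h0.
have : (cabs (phi ((r^-1)%:C *: h)) <= norm)%E.
  apply: ereal_sup_ubound; exists ((r^-1)%:C *: h) => //=.
  rewrite lp_normZ// cmodR ger0_norm ?invr_ge0 ?(ltW h0)// hE -EFinM.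
  by rewrite mulVf ?(gt_eqF h0).
rewrite (bounded_linearZ _ _ _ p1 bphi)// /cabs cmodM cmodR.
rewrite ger0_norm ?invr_ge0 ?(ltW h0)// hE.
by rewrite -lee_pdivrMr// muleC -EFinM.
Qed.

(* For [1 < p], test [phi] on [a = |g| ^ p' / g] restricted to finite sets:
   [a * g = |a| ^ p = |g| ^ p'].  Where [g] vanishes, [a = 0] as [0^-1 = 0]. *)
Lemma lp_norm_functional_le :
  (lp_norm (hoelder_conjugate p%:E) (fun y => phi (point_mass y)) <= norm)%E.
Proof.
set g := fun y => phi (point_mass y).
(* At [p = 1] the norm of [g] is a supremum, and testing on point masses, which have norm 1, is
   enough. *)
have [pE|pn1] := eqVneq p 1.
  rewrite {1}pE hoelder_conjugate1; apply: lp_normy_le => [|y].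
    exact: op_norm_ge0.
  have := cabs_le_op_norm _ (point_mass_fin p y p1).
  by rewrite lp_norm_point_mass// mule1.
have p0 : 0 < p by rewrite (lt_le_trans ltr01).
have pgt1 : 1 < p by rewrite lt_neqAle eq_sym pn1.
pose p' := p / (p - 1).
have pm10 : p - 1 != 0 by rewrite subr_eq0.
have p'E : hoelder_conjugate p%:E = p'%:E by exact: hoelder_conjugate_gt1.
have p'0 : 0 < p' by rewrite divr_gt0// subr_gt0.
have p'1 : 1 <= p'.
  by rewrite -lee_fin -p'E hoelder_conj_ge1.
have pp' : p^-1 + p'^-1 = 1.
  by rewrite /p' invf_div -{1}(div1r p) -mulrDl subrKC mulfV// gt_eqF.
rewrite p'E -(poweR_le _ _ p')// ?lp_norm_ge0 ?op_norm_ge0//.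
rewrite poweR_lp_norm//; apply: integral_counting_le => [y|s us].
  by rewrite lee_fin powR_ge0.
rewrite sumEFin; set S := \sum_(y <- s) _.
have S0 : 0 <= S by apply: sumr_ge0 => y _; exact: powR_ge0.
pose a y : R[i] := (cmod (g y) `^ p')%:C / g y.
have agE y : a y * g y = (cmod (g y) `^ p')%:C.
  rewrite /a; have [->|gy0] := eqVneq (g y) 0; last by rewrite divfK.
  by rewrite mulr0 cmod0 powR0// gt_eqF.
have aE y : cmod (a y) `^ p = cmod (g y) `^ p'.
  have [gy0|gy0] := eqVneq (g y) 0.
    by rewrite /a gy0 invr0 mulr0 cmod0 !powR0// gt_eqF.
  have cg0 : 0 < cmod (g y) by rewrite lt_def cmod_eq0 gy0 cmod_ge0.
  rewrite /a cmodM cmodR cmodV ger0_norm ?powR_ge0//.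
  rewrite -powR_inv1 ?cmod_ge0// -powRD; last by rewrite (gt_eqF cg0) implybT.
  rewrite -powRrM; congr (_ `^ _).
  (* The exponent identity is [(p' - 1) * p = p']. *)
  by rewrite mulrDl mulN1r /p'; field.
pose h := \sum_(y <- s) a y *: point_mass y : X -> R[i]^o.
have hoo : fin_norm (lp_norm p%:E) h by exact: fin_norm_sum.
have phih : phi h = S%:C.
  rewrite (bounded_linear_sum _ _ _ p1 bphi) rmorph_sum/=.
  by apply: eq_bigr => y _; rewrite -agE.
have hx x : h x = if x \in s then a x else 0 by exact: point_mass_sum_apply.
have hS : (lp_norm p%:E h = (S `^ p^-1)%:E).
  rewrite (lp_norm_seq _ _ _ p1 us) => [|x /negPf xs]; last by rewrite hx xs.
  congr (_ `^ _)%:E; apply: eq_big_seq => y ys.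
  by rewrite hx ys aE.
have := cabs_le_op_norm _ hoo.
rewrite phih hS /cabs cmodR ger0_norm//.
have normE : norm = (fine norm)%:E.
  by rewrite fineK// ge0_fin_numE ?op_norm_ge0// op_norm_lty.
have norm0 : 0 <= fine norm by rewrite fine_ge0// op_norm_ge0.
rewrite normE -EFinM poweR_EFin !lee_fin.
(* The test on [h] bounds [S] by the operator norm times the [p]-th root of [S]. Dividing by that
   root, for [S] nonzero, leaves the [p']-th root of [S] on the left. *)
have [->|Sn0 Sle] := eqVneq S 0; first by rewrite powR_ge0.
have Sgt0 : 0 < S by rewrite lt_def Sn0.
have SE : S = S `^ p'^-1 * S `^ p^-1.
  by rewrite -powRD ?Sn0 ?implybT// addrC pp' powRr1.
have : S `^ p'^-1 <= fine norm.
  by rewrite -(ler_pM2r (powR_gt0 p^-1 Sgt0)) -SE.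
move=> normS; have -> : S = (S `^ p'^-1) `^ p'.
  by rewrite -powRrM mulVf ?gt_eqF// powRr1.
by rewrite ge0_ler_powR ?nnegrE ?powR_ge0// ltW.
Qed.

End functionals.

(** * The duality pairing of [l^p] and [l^p'] *)

Section pairing.
Context (p : R) (p1 : 1 <= p).
Local Notation mu := (@counting X R : measure X R).

(** Bilinear, without complex conjugation, so that pairing [g] with a point mass returns [g y]
    itself. *)
Definition pairing (g h : X -> R[i]^o) : R[i]^o :=
  cintegral mu setT (fun x => h x * g x).

Lemma cintegrable_pairing g h :
  fin_norm (lp_norm p%:E) h ->
  fin_norm (lp_norm (hoelder_conjugate p%:E)) g ->
  cintegrable mu setT (fun x => h x * g x).
Proof.
move=> hoo goo; split; first by split; exact: measurable_vertex.
apply: le_lt_trans (lp_hoelder _ _ _ p1) _.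
have := lp_norm_ge0 p%:E h; move: hoo; rewrite /fin_norm /=.
have := lp_norm_ge0 (hoelder_conjugate p%:E) g; move: goo; rewrite /fin_norm /=.
case: (lp_norm _ g) => // r _ _; case: (lp_norm _ h) => // r' _ _.
by rewrite -EFinM ltry.
Qed.

Lemma pairing_le g h :
  fin_norm (lp_norm p%:E) h ->
  fin_norm (lp_norm (hoelder_conjugate p%:E)) g ->
  (cabs (pairing g h) <= lp_norm (hoelder_conjugate p%:E) g * lp_norm p%:E h)%E.
Proof.
move=> hoo goo.
have := cmod_cintegral_le measurableT _ (cintegrable_pairing g h hoo goo).
by move=> /le_trans; apply; rewrite muleC; exact: lp_hoelder.
Qed.

Lemma pairing_bounded_linear g :
  fin_norm (lp_norm (hoelder_conjugate p%:E)) g ->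
  bounded_linear (lp_norm p%:E) (@cabs R) (pairing g).
Proof.
move=> goo; split=> [a x y xoo yoo|].
  have xg := cintegrable_pairing g x xoo goo.
  have yg := cintegrable_pairing g y yoo goo.
  rewrite /pairing [X in cintegral _ _ X](_ : _ =
      fun t => a * (x t * g t) + y t * g t).
    by rewrite cintegralD ?cintegralZ//; exact: cintegrableZ.
  by apply/funext => t; rewrite !fctE mulrDl mulrA.
exists (fine (lp_norm (hoelder_conjugate p%:E) g)) => x xoo.
rewrite fineK; first exact: pairing_le.
by rewrite ge0_fin_numE// lp_norm_ge0.
Qed.

Lemma op_norm_pairing_le g :
  fin_norm (lp_norm (hoelder_conjugate p%:E)) g ->
  (op_norm (lp_norm p%:E) (@cabs R) (pairing g) <=
   lp_norm (hoelder_conjugate p%:E) g)%E.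
Proof.
move=> goo; apply: ge_ereal_sup => _ [h /= h1 <-].
rewrite (le_trans (pairing_le g h _ goo))//.
  by rewrite /fin_norm /= (le_lt_trans h1)// ltry.
by rewrite -[leRHS]mule1 lee_wpmul2l// lp_norm_ge0.
Qed.

Lemma pairing_point_mass g y : pairing g (point_mass y) = g y.
Proof.
(* The case of a real function concentrated at [y], used for both the real and the imaginary
   part. *)
have E (F : X -> R) : (forall x, x != y -> F x = 0) ->
    \int[mu]_(x in setT) F x = F y.
  move=> F0; rewrite (_ : F = fun x => F y * \1_[set y] x).
    rewrite RintegralZl//.
      rewrite /Rintegral integral_indic// setIT /= counting_set1 /=.
      by rewrite indicE mem_set// mulr1.
    apply/integrableP; split; first exact: measurable_vertex.
    rewrite (integral_counting_seq _ [:: y])//.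
      by rewrite big_seq1 /= ltry.
    move=> x; rewrite inE /= indicE => xy.
    by rewrite memNset ?normr0//=; exact/eqP.
  apply/funext => x; rewrite indicE; have [->|xy] := eqVneq x y.
    by rewrite mem_set// mulr1.
  by rewrite F0// memNset ?mulr0//=; exact/eqP.
rewrite /pairing /cintegral !E /point_mass ?eqxx ?mul1r; first by case: (g y).
- by move=> x /negPf ->; rewrite mul0r.
- by move=> x /negPf ->; rewrite mul0r.
Qed.

End pairing.
End point_masses.

(** * The nuclear operator defined by a summable series *)

Section nuclear_series.
Context {R : realType} {q : nat} {X : htree q}.
Context (p1 p2 : R) (hp1 : 1 <= p1) (hp2 : 1 <= p2).
Context (g f : nat -> X -> R[i]^o).
Hypothesis goo : forall k, fin_norm (lp_norm (hoelder_conjugate p1%:E)) (g k).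
Hypothesis foo : forall k, fin_norm (lp_norm p2%:E) (f k).

Local Notation N1 := (@lp_norm R q X p1%:E).
Local Notation N1' := (@lp_norm R q X (hoelder_conjugate p1%:E)).
Local Notation N2 := (@lp_norm R q X p2%:E).

Hypothesis gf_summable : (\sum_(k <oo) N1' (g k) * N2 (f k) < +oo)%E.

(** The sum is taken vertex by vertex; its convergence in the [p2] norm is recovered in
    [series_operator_tail]. *)
Definition series_operator (h : X -> R[i]^o) : X -> R[i]^o :=
  fun x => limn (series (fun k => pairing (g k) h * f k x) : nat -> R[i]^o).

Let gf_ge0 k : (0 <= N1' (g k) * N2 (f k))%E.
Proof. by rewrite mule_ge0// lp_norm_ge0. Qed.

Lemma lp_norm_term_le h k : fin_norm N1 h ->
  (N2 (pairing (g k) h *: f k) <= N1 h * (N1' (g k) * N2 (f k)))%E.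
Proof.
move=> hoo; rewrite lp_normZ// muleA lee_wpmul2r ?lp_norm_ge0//.
by rewrite muleC; apply: pairing_le.
Qed.

(** The value of each term at [x] is at most its [p2] norm, and these norms are summable by Hoelder
    and [gf_summable]. *)
Lemma series_operator_cvg h x : fin_norm N1 h ->
  (series (fun k => pairing (g k) h * f k x) : nat -> R[i]^o) @ \oo -->
  series_operator h x.
Proof.
move=> hoo; apply: cmod_summable_cvg.
apply: (@le_lt_trans _ _ (\sum_(k <oo) N1 h * (N1' (g k) * N2 (f k)))%E).
  apply: lee_nneseries => [k _ _|k _]; first by rewrite lee_fin cmod_ge0.
  rewrite (le_trans _ (lp_norm_term_le h k hoo))//.
  exact: cmod_le_lp_norm.
have hfin : N1 h \is a fin_num by rewrite ge0_fin_numE// lp_norm_ge0.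
rewrite -(fineK hfin) nneseriesZl; last by move=> k _.
by rewrite fineK// lte_mul_pinfty// lp_norm_ge0.
Qed.

(** The triangle inequality bounds the finite sums over [m <= k < n], and Fatou lets [n] tend to
    infinity. The case [m = 0] gives boundedness of the operator; [m] tending to infinity gives
    nuclear convergence. *)
Lemma series_operator_tail h m : fin_norm N1 h ->
  (N2 (series_operator h - \sum_(k < m) pairing (g k) h *: f k)%R
   <= N1 h * \sum_(m <= k <oo) N1' (g k) * N2 (f k))%E.
Proof.
move=> hoo.
apply: (lp_norm_fatou _
    (fun n => \sum_(m <= k < n) pairing (g k) h *: f k)) => // [x|n].
  pose S : nat -> R[i]^o := series (fun k => pairing (g k) h * f k x).
  rewrite [X in _ --> X](_ : _ = series_operator h x - S m); last first.
    rewrite !fctE fct_sumE /S /series /= big_mkord.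
    by congr (_ - _); apply: eq_bigr.
  have : (S n - S m) @[n --> \oo] --> series_operator h x - S m.
    by apply: cvgB; [exact: series_operator_cvg|exact: cvg_cst].
  (* The sum over [m <= k < n] equals [S n - S m] only once [n >= m]. *)
  apply: cvg_trans; apply: near_eq_cvg.
  by exists m => // n /= mn; rewrite fct_sumE sub_series_geq.
rewrite (le_trans (lp_norm_sum _ _ _ _ hp2))//.
apply: (@le_trans _ _ (\sum_(m <= k < n) N1 h * (N1' (g k) * N2 (f k)))%E).
  by apply: lee_sum => k _; exact: lp_norm_term_le.
rewrite -ge0_sume_distrr; last by move=> k _.
rewrite lee_wpmul2l ?lp_norm_ge0//.
by apply: nneseries_lim_ge => k _ _.
Qed.

Lemma series_operator_bounded_linear : bounded_linear N1 N2 series_operator.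
Proof.
split=> [a h1 h2 h1oo h2oo|].
  have E k : pairing (g k) (a *: h1 + h2) =
      a * pairing (g k) h1 + pairing (g k) h2.
    by rewrite (pairing_bounded_linear _ hp1 _ (goo k)).1.
  apply/funext => x; apply: cvg_lim => //.
  rewrite [X in X @ _ --> _](_ : _ = fun n =>
      a * series (fun k => pairing (g k) h1 * f k x) n +
      series (fun k => pairing (g k) h2 * f k x) n); last first.
    apply/funext => n; rewrite /series /= mulr_sumr -big_split /=.
    by apply: eq_bigr => k _; rewrite E mulrDl mulrA.
  apply: cvgD; last exact: series_operator_cvg.
  apply: cvgM; first exact: cvg_cst.
  exact: series_operator_cvg.
exists (fine (\sum_(k <oo) N1' (g k) * N2 (f k))%E) => h hoo.
rewrite fineK ?ge0_fin_numE ?nneseries_ge0//.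
by have := series_operator_tail h 0 hoo; rewrite big_ord0 subr0 muleC.
Qed.

Lemma series_operator_nuclear : nuclear N1 N2 series_operator.
Proof.
split; first exact: series_operator_bounded_linear.
exists (fun k => pairing (g k)), f; split => //.
- by move=> k; exact: pairing_bounded_linear.
- apply: le_lt_trans gf_summable; apply: lee_nneseries => k _.
    rewrite mule_ge0 ?lp_norm_ge0//.
    by apply: op_norm_ge0 => //; exact: pairing_bounded_linear.
  by rewrite lee_wpmul2r ?lp_norm_ge0//; exact: op_norm_pairing_le.
- move=> h hoo.
  apply: (@squeeze_cvge _ _ _ _ (cst 0%E) _
    (fun m => N1 h * \sum_(m <= k <oo) N1' (g k) * N2 (f k))%E).
  + by apply: nearW => m; rewrite lp_norm_ge0 series_operator_tail.
  + exact: cvg_cst.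
  + rewrite -[X in _ --> X](mule0 (N1 h)); apply: cvgeZl.
      by rewrite ge0_fin_numE ?lp_norm_ge0.
    exact: nneseries_tail_cvg.
Qed.

End nuclear_series.

(** * The pseudo-differential operator on finitely supported functions *)

Section pseudo_differential_operator.
Context {R : realType} {q : nat} {X : htree q}.
Context {nu : probability (boundary X) R}.
Context {sigma : X -> boundary X -> R -> R[i]}.
Implicit Types (f : X -> R[i]^o) (s : seq X).

(** The Fourier-Helgason transform is here a finite sum, so integrability and linearity of the
    operator reduce to those of finitely many kernel integrands. *)
Lemma pdo_integrandE f s x u : uniq s -> (forall y, y \notin s -> f y = 0) ->
  pdo_integrand sigma f x u = \sum_(y <- s) f y * kernel_integrand sigma x y u.
Proof.
move=> us fs; rewrite /pdo_integrand /fourier_helgason.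
rewrite (fsbigE s)//=; last by move=> y _ /fs ->; rewrite mul0r.
rewrite big_mkcond /= mulr_sumr; apply: eq_bigr => y _.
by rewrite in_setT /kernel_integrand; ring.
Qed.

(** This identifies the spectral integral of the kernel with the operator's value at [x] on the
    point mass at [y]. *)
Lemma pdo_integrand_point_mass x y :
  pdo_integrand sigma (point_mass y) x = kernel_integrand sigma x y.
Proof.
apply/funext => u; rewrite (pdo_integrandE _ [:: y])//.
  by rewrite big_seq1 /point_mass eqxx mul1r.
by move=> z; rewrite inE /point_mass => /negPf ->.
Qed.

Hypothesis ikernel : forall x y,
  spectral_integrable nu (kernel_integrand sigma x y).

Let measurable_spectrum :
  measurable ([set: boundary X] `*` `[0, tau R q] : set (boundary X * R)).
Proof. by apply: measurableX. Qed.

Lemma spectral_integrable_pdo f s x : uniq s ->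
  (forall y, y \notin s -> f y = 0) ->
  spectral_integrable nu (pdo_integrand sigma f x).
Proof.
move=> us fs; rewrite (funext (fun u => pdo_integrandE f s x u us fs)).
apply: cintegrable_sum => // y; apply: cintegrableZ => //; exact: ikernel.
Qed.

Lemma pdoE f s : uniq s -> (forall y, y \notin s -> f y = 0) ->
  pdo nu sigma f = \sum_(y <- s) f y *: pdo nu sigma (point_mass y).
Proof.
move=> us fs; apply/funext => x; rewrite fct_sumE /pdo.
rewrite (funext (fun u => pdo_integrandE f s x u us fs)).
rewrite /spectral_integral cintegral_sum//; last first.
  by move=> y; apply: cintegrableZ => //; exact: ikernel.
apply: eq_bigr => y _; rewrite cintegralZ//; last exact: ikernel.
by rewrite fctE pdo_integrand_point_mass.
Qed.

End pseudo_differential_operator.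

(** * Finite supports, and the two implications of the characterisation *)

Lemma finitely_supportedP (R : realType) (q : nat) (X : htree q)
  (f : X -> R[i]^o) : finitely_supported f ->
  exists2 s : seq X, uniq s & forall y, y \notin s -> f y = 0.
Proof.
move=> ff; exists (fset_set [set x | f x != 0]); first exact: fset_uniq.
move=> y; rewrite in_fset_set// notin_setE /= => /negP.
by rewrite negbK => /eqP.
Qed.

Lemma point_mass_supported (R : realType) (q : nat) (X : htree q) (y : X) :
  finitely_supported (point_mass y : X -> R[i]^o).
Proof.
apply: (@sub_finite_set _ _ [set y]) => // x /=; rewrite /point_mass.
by have [->//|_] := eqVneq x y; rewrite mulr0n eqxx.
Qed.

Theorem theorem5p3 (R : realType) (q : nat) (X : htree q)
  (nu : probability (boundary X) R) (nuE : is_boundary_measure nu)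
  (sigma : X -> boundary X -> R -> R[i]) (msigma : symbol_measurable sigma)
  (p1 p2 : R) (hp1 : 1 <= p1) (hp2 : 1 <= p2) :
  pdo_nuclear nu sigma p1%:E p2%:E <->
  exists (g f : nat -> X -> R[i]^o),
    [/\ forall k, fin_norm (lp_norm (hoelder_conjugate p1%:E)) (g k),
        forall k, fin_norm (lp_norm p2%:E) (f k),
        (\sum_(k <oo) lp_norm (hoelder_conjugate p1%:E) (g k)
                      * lp_norm p2%:E (f k) < +oo)%E &
        forall x y : X,
          spectral_integrable nu (kernel_integrand sigma x y) /\
          (series (fun k => f k x * g k y) : nat -> R[i]^o) @ \oo -->
          (spectral_integral nu (kernel_integrand sigma x y) : R[i]^o)].
Proof.
split=> [[ipdo [T [Tpdo [bT [x' [f [bx' foo xf_summable Tcvg]]]]]]]|].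
  (* From nuclearity to the kernel: the coefficients of the functionals lie in [l^p1'], with norms
     at most the operator norms, so summability is inherited. *)
  pose g k y := x' k (point_mass y).
  have g_le k := lp_norm_functional_le _ _ hp1 (bx' k).
  exists g, f; split => //.
  - by move=> k; apply: le_lt_trans (g_le k) _; exact: op_norm_lty.
  - apply: le_lt_trans xf_summable; apply: lee_nneseries => [k _ _|k _].
      by rewrite mule_ge0 ?lp_norm_ge0.
    by apply: lee_wpmul2r; [exact: lp_norm_ge0|exact: g_le].
  move=> x y; have ym : finitely_supported (point_mass y : X -> R[i]^o).
    exact: point_mass_supported.
  have := ipdo _ x ym; rewrite pdo_integrand_point_mass; split => //.
  apply/cvg_cmodP.
  have <- : T (point_mass y) x =
      spectral_integral nu (kernel_integrand sigma x y).
    by rewrite Tpdo// /pdo pdo_integrand_point_mass.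
  (* The nuclear series converges in norm on the point mass at [y]; evaluation at [x] is dominated
     by the norm and gives the kernel series. *)
  have Ty := Tcvg _ (point_mass_fin _ y hp1).
  suff : (cmod (T (point_mass y) x - series (fun k => f k x * g k y) n))%:E
      @[n --> \oo] --> (0 : R)%:E by move/fine_cvg.
  apply: squeeze_cvge Ty; last exact: cvg_cst.
  apply: nearW => n; rewrite lee_fin cmod_ge0 /=.
  apply: le_trans (cmod_le_lp_norm _ _ x hp2); rewrite lee_fin.
  rewrite le_eqVlt; apply/orP; left; apply/eqP; congr cmod.
  rewrite !fctE fct_sumE /series /= big_mkord; congr (_ - _).
  by apply: eq_bigr => k _; rewrite mulrC.
(* From the kernel to nuclearity: [series_operator g f] is nuclear and remains to be identified with
   the operator on finite supports. *)
move=> [g [f [goo foo gf_summable ker]]].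
have ikernel x y := (ker x y).1.
have kerE x y := (ker x y).2.
split=> [h x /finitely_supportedP[s us hs]|].
  exact: spectral_integrable_pdo us hs.
exists (series_operator g f); split; last exact: series_operator_nuclear.
move=> h /finitely_supportedP[s us hs].
have bT := series_operator_bounded_linear _ _ hp1 hp2 _ _ goo gf_summable.
(* Both operators are linear on finite combinations of point masses, so it suffices to compare them
   on one point mass. *)
rewrite {1}(point_mass_sumE h s us hs) (bounded_linear_sum _ _ _ hp1 bT).
rewrite (pdoE ikernel _ _ us hs); apply: eq_bigr => y _; congr (_ *: _).
apply/funext => x; rewrite /pdo pdo_integrand_point_mass.
(* On the point mass at [y] the pairing with [g k] is [g k y], so the series is the given expansion
   of the kernel. *)
apply: cvg_lim => //; apply: cvg_trans (kerE x y).
apply: near_eq_cvg; apply: nearW => n; apply: eq_bigr => k _.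
by rewrite pairing_point_mass mulrC.
Qed.
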